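(* Let $n\ge 2$ and let $a,a',\lambda_i,\lambda_i'\in\mathbb{C}^*$, $1\le i\le n$. Then $$\Omega_{1-a}(\lambda_1,\dots,\lambda_n)\cong\Omega_{1-a'}(\lambda_1',\dots,\lambda_n')$$ as $\mathfrak{sl}_{n+1}(\mathbb{C})$-modules if and only if $a=a'$ and $\lambda_i=\lambda_i'$ for all $1\le i\le n$.
   Context: Let $\partial_i=t_i\frac{\partial}{\partial t_i}$ ($1\le i\le n$) on $\mathbb{C}[t_1^{\pm1},\dots,t_n^{\pm1}]$; for $u\in\mathbb{C}^n$, $j\in\mathbb{Z}^n$ put $D(u,j)=t_1^{j_1}\cdots t_n^{j_n}\sum_i u_i\partial_i$ and $(u|j)=\sum_i u_ij_i$. The Witt algebra $\mathcal{W}_n$ is the Lie algebra of derivations of $\mathbb{C}[t_1^{\pm1},\dots,t_n^{\pm1}]$, spanned by all $D(u,j)$. Embedding of $\mathfrak{sl}_{n+1}(\mathbb{C})$ in $\mathcal{W}_n$: put $e_{ij}=t_it_j^{-1}\partial_j$ ($1\le i,j\le n$), $e_{i,n+1}=-t_i\sum_{j=1}^n\partial_j$, $e_{n+1,i}=t_i^{-1}\partial_i$ ($1\le i\le n$), $e_{n+1,n+1}=-\sum_{j=1}^n\partial_j$. Then $\{e_{ij}:1\le i\ne j\le n+1\}\cup\{e_{ii}-e_{i+1,i+1}:1\le i\le n\}$ is the standard basis of $\mathfrak{sl}_{n+1}(\mathbb{C})\subset\mathcal{W}_n$. The module $\Omega_{1-a}(\lambda_1,\dots,\lambda_n)$ ($a\in\mathbb{C}$,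 $\lambda_i\in\mathbb{C}^*$): its underlying space is the polynomial algebra $\mathbb{C}[\partial_1,\dots,\partial_n]$ in commuting indeterminates, with $\mathcal{W}_n$ acting by $$D(u,j)\circ f(\partial_1,\dots,\partial_n)=\lambda_1^{j_1}\cdots\lambda_n^{j_n}\Big(\sum_{i=1}^nu_i\partial_i-a(u|j)\Big)f(\partial_1-j_1,\dots,\partial_n-j_n),$$ and it is regarded as an $\mathfrak{sl}_{n+1}(\mathbb{C})$-module by restriction. *)

(* Defs.v *)
From HB Require Import structures.
From mathcomp Require Import all_boot all_order all_algebra.
From mathcomp Require Import finmap ring.
From mathcomp Require Export reals complex.
From mathcomp Require Import monalg.
From mathcomp Require Import mpoly.

Set Implicit Arguments.
Unset Strict Implicit.
Unset Printing Implicit Defensive.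

Import GRing.Theory.

Local Open Scope fset_scope.
Local Open Scope ring_scope.

(* ------------------------------------------------------------------------ *)
(* C[t_1^{+-1}, ..., t_n^{+-1}]: finitely supported functions of the exponent
   vector, with the convolution product. The ring structure of malg is not
   available here, because a monomType has no invertible element but 1. *)

Definition laurent (C : fieldType) (n : nat) : Type := {malg C['rV[int]_n]}.

HB.instance Definition _ (C : fieldType) n :=
  GRing.Lmodule.copy (laurent C n) {malg C['rV[int]_n]}.

(* lterm, lcoeff, lsupp and lmul are locked: unification would otherwise unfold
   them down to finite maps on matrices. *)

(* The term c t^k. *)
HB.lock Definition lterm (C : fieldType) n (c : C) (k : 'rV[int]_n)
  : laurent C n := monalg.mkmalgU k c.

(* The coefficient of t^k. *)
HB.lock Definition lcoeff (C : fieldType) n (k : 'rV[int]_n)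
  (f : laurent C n) : C := monalg.mcoeff k f.

(* The finite set of the exponents with nonzero coefficient. *)
HB.lock Definition lsupp (C : fieldType) n (f : laurent C n)
  : {fset 'rV[int]_n} := monalg.msupp f.

HB.lock Definition lmul (C : fieldType) n (f g : laurent C n)
  : laurent C n :=
  \sum_(i <- lsupp f) \sum_(j <- lsupp g)
     lterm (lcoeff i f * lcoeff j g) (i + j).

Arguments lterm {C n} c k.
Arguments lcoeff {C n} k f.
Arguments lsupp {C n} f.
Arguments lmul {C n} f g.

Section LaurentRing.
Variables (C : fieldType) (n : nat).
Local Notation L := (laurent C n).
Implicit Types (f g h : L) (i j k : 'rV[int]_n) (a b c : C).

Lemma lcoeffP f g : (forall k, lcoeff k f = lcoeff k g) -> f = g.
Proof. by move=> fg; apply/monalg.malgP => k; have := fg k; rewrite lcoeff.unlock. Qed.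

Lemma lcoeff_outdom f k : k \notin lsupp f -> lcoeff k f = 0.
Proof. rewrite ?lterm.unlock ?lcoeff.unlock ?lsupp.unlock; exact: monalg.mcoeff_outdom. Qed.

Lemma lcoeff0 k : lcoeff k (0 : L) = 0.
Proof. rewrite ?lterm.unlock ?lcoeff.unlock ?lsupp.unlock; exact: monalg.mcoeff0. Qed.

Lemma lsupp0 : lsupp (0 : L) = fset0.
Proof. rewrite ?lterm.unlock ?lcoeff.unlock ?lsupp.unlock; exact: monalg.msupp0. Qed.

Lemma lsuppD f g : lsupp (f + g) `<=` lsupp f `|` lsupp g.
Proof. rewrite ?lterm.unlock ?lcoeff.unlock ?lsupp.unlock; exact: monalg.msuppD_le. Qed.

Lemma lcoeffD k f g : lcoeff k (f + g : L) = lcoeff k f + lcoeff k g.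
Proof. rewrite ?lterm.unlock ?lcoeff.unlock ?lsupp.unlock; exact: monalg.mcoeffD. Qed.

Lemma lcoeffZ k c f : lcoeff k (c *: f : L) = c * lcoeff k f.
Proof. rewrite ?lterm.unlock ?lcoeff.unlock ?lsupp.unlock; exact: monalg.mcoeffZ. Qed.

Lemma lcoeff_term l c k : lcoeff l (lterm c k) = c *+ (k == l).
Proof. rewrite ?lterm.unlock ?lcoeff.unlock ?lsupp.unlock; exact: monalg.mcoeffU. Qed.

Lemma lsupp_term c k : lsupp (lterm c k) `<=` [fset k].
Proof. rewrite ?lterm.unlock ?lcoeff.unlock ?lsupp.unlock; exact: monalg.msuppU_le. Qed.

Lemma lterm0 k : lterm 0 k = 0 :> L.
Proof. rewrite ?lterm.unlock ?lcoeff.unlock ?lsupp.unlock; exact: monalgU0. Qed.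

Lemma ltermD k a b : lterm (a + b) k = lterm a k + lterm b k :> L.
Proof. rewrite ?lterm.unlock ?lcoeff.unlock ?lsupp.unlock; exact: monalg.monalgUD. Qed.

Lemma ltermZ a b k : a *: lterm b k = lterm (a * b) k.
Proof.
by apply: lcoeffP => l; rewrite lcoeffZ !lcoeff_term mulrnAr.
Qed.

Lemma lexpand f : f = \sum_(k <- lsupp f) lterm (lcoeff k f) k.
Proof. rewrite ?lterm.unlock ?lcoeff.unlock ?lsupp.unlock; exact: monalgE. Qed.

Lemma lmulEw (d1 d2 : {fset 'rV[int]_n}) f g :
  lsupp f `<=` d1 -> lsupp g `<=` d2 ->
  lmul f g = \sum_(i <- d1) \sum_(j <- d2)
     lterm (lcoeff i f * lcoeff j g) (i + j).
Proof.
move=> s1 s2; rewrite lmul.unlock (big_fset_incl _ s1) /=.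
  apply: eq_bigr => i _; apply: big_fset_incl => // j _ /lcoeff_outdom ->.
  by rewrite mulr0 lterm0.
move=> i _ /lcoeff_outdom fi0.
by rewrite big1 // => j _; rewrite fi0 mul0r lterm0.
Qed.

Lemma lmulDl : left_distributive (@lmul C n) +%R.
Proof.
move=> f g h.
rewrite (lmulEw (fsubsetUl (lsupp f) (lsupp g)) (fsubset_refl (lsupp h))).
rewrite (lmulEw (fsubsetUr (lsupp f) (lsupp g)) (fsubset_refl (lsupp h))).
rewrite (lmulEw (lsuppD f g) (fsubset_refl (lsupp h))).
rewrite -big_split /=; apply: eq_bigr => i _.
rewrite -big_split /=; apply: eq_bigr => j _.
by rewrite lcoeffD mulrDl ltermD.
Qed.

Lemma lmulC : commutative (@lmul C n).
Proof.
move=> f g; rewrite lmul.unlock exchange_big; apply: eq_bigr => i _.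
by apply: eq_bigr => j _; rewrite mulrC addrC.
Qed.

Lemma lmulDr : right_distributive (@lmul C n) +%R.
Proof. by move=> f g h; rewrite lmulC lmulDl !(lmulC f). Qed.

Lemma lmul0l : left_zero 0 (@lmul C n).
Proof. by move=> f; rewrite lmul.unlock lsupp0 big_seq_fset0. Qed.

Lemma lmul0r : right_zero 0 (@lmul C n).
Proof. by move=> f; rewrite lmulC lmul0l. Qed.

Lemma lmul_suml (I : Type) (r : seq I) (F : I -> L) g :
  lmul (\sum_(x <- r) F x) g = \sum_(x <- r) lmul (F x) g.
Proof. exact: (big_morph (lmul^~ g) (fun f h => lmulDl f h g) (lmul0l g)). Qed.

Lemma lmul_sumr (I : Type) (r : seq I) (F : I -> L) g :
  lmul g (\sum_(x <- r) F x) = \sum_(x <- r) lmul g (F x).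
Proof. exact: (big_morph (lmul g) (lmulDr g) (lmul0r g)). Qed.

Lemma lmul_term a b i j :
  @lmul C n (lterm a i) (lterm b j) = lterm (a * b) (i + j).
Proof.
by rewrite (lmulEw (lsupp_term _ _) (lsupp_term _ _))
  !big_seq_fset1 !lcoeff_term !eqxx.
Qed.

Lemma lmulA : associative (@lmul C n).
Proof.
move=> f g h; rewrite (lexpand f) (lexpand g) (lexpand h).
rewrite !lmul_suml; apply: eq_bigr => i _.
rewrite lmul_sumr (lmul_sumr (lsupp g)) lmul_suml; apply: eq_bigr => j _.
rewrite !lmul_sumr; apply: eq_bigr => k _.
by rewrite !lmul_term mulrA addrA.
Qed.

Lemma lmul1l : left_id (lterm 1 0) (@lmul C n).
Proof.
move=> f; rewrite [in LHS](lexpand f) lmul_sumr [RHS]lexpand.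
by apply: eq_bigr => k _; rewrite lmul_term mul1r add0r.
Qed.

Lemma lone_neq0 : lterm 1 0 != 0 :> L.
Proof. by rewrite lterm.unlock monalgU_eq0 oner_eq0. Qed.

HB.instance Definition _ := GRing.Zmodule_isComNzRing.Build L
  lmulA lmulC lmul1l lmulDl lone_neq0.

Lemma lscaleAl c f g : c *: (f * g) = (c *: f) * g.
Proof.
change (c *: lmul f g = lmul (c *: f) g).
rewrite (lexpand f) (lexpand g) lmul_suml !scaler_sumr lmul_suml.
apply: eq_bigr => i _; rewrite !lmul_sumr scaler_sumr.
by apply: eq_bigr => j _; rewrite ltermZ !lmul_term ltermZ mulrA.
Qed.

HB.instance Definition _ := GRing.Lmodule_isLalgebra.Build C L lscaleAl.
HB.instance Definition _ := GRing.Lalgebra_isComAlgebra.Build C L.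

Lemma lsupp_sumw (V : lmodType C) (F : 'rV[int]_n -> V) f
    (d : {fset 'rV[int]_n}) : lsupp f `<=` d ->
  \sum_(k <- lsupp f) lcoeff k f *: F k = \sum_(k <- d) lcoeff k f *: F k.
Proof.
move=> fd; apply: (big_fset_incl _ fd) => k _ /lcoeff_outdom ->.
by rewrite scale0r.
Qed.

Lemma ltermM a b i j : lterm a i * lterm b j = lterm (a * b) (i + j) :> L.
Proof. exact: lmul_term. Qed.

End LaurentRing.

(* ------------------------------------------------------------------------ *)
Section WittAlgebra.
Variables (C : fieldType) (n : nat).
Local Notation L := (laurent C n).

(* The unit exponent vector of t_i. *)
Definition eps (i : 'I_n) : 'rV[int]_n := delta_mx 0 i.

(* The monomial t_1^{j_1} ... t_n^{j_n}. *)
Definition tmon (j : 'rV[int]_n) : L := lterm 1 j.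

(* partial_i = t_i d/dt_i sends t^k to k_i t^k. *)
Definition tpartial (i : 'I_n) (f : L) : L :=
  \sum_(k <- lsupp f) lterm ((k 0 i)%:~R * lcoeff k f) k.

Definition is_derivation (d : L -> L) : Prop :=
  linear d /\ forall f g : L, d (f * g) = d f * g + f * d g.

(* (u|j) *)
Definition pairing (u : 'rV[C]_n) (j : 'rV[int]_n) : C :=
  \sum_(i < n) u 0 i * (j 0 i)%:~R.

(* D(u,j) = t^j \sum_i u_i partial_i. *)
Definition witt_D (u : 'rV[C]_n) (j : 'rV[int]_n) (f : L) : L :=
  tmon j * \sum_(i < n) u 0 i *: tpartial i f.

(* The last index n + 1 is ord_max : 'I_n.+1. *)
Definition sl_e (i j : 'I_n.+1) (f : L) : L :=
  match unlift ord_max i, unlift ord_max j with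
  | Some i', Some j' => tmon (eps i') * tmon (- eps j') * tpartial j' f
  | Some i', None => - (tmon (eps i') * \sum_(k < n) tpartial k f)
  | None, Some j' => tmon (- eps j') * tpartial j' f
  | None, None => - \sum_(k < n) tpartial k f
  end.

(* The span of e_ij, i <> j, and of e_ii - e_{i+1,i+1}, 1 <= i <= n. *)
Definition sl_mem (x : L -> L) : Prop :=
  exists (c : 'M[C]_n.+1) (d : 'rV[C]_n), forall f : L,
    x f = \sum_(i < n.+1) \sum_(j < n.+1 | j != i) c i j *: sl_e i j f
        + \sum_(i < n) d 0 i *:
            (sl_e (widen_ord (leqnSn n) i) (widen_ord (leqnSn n) i) f
             - sl_e (lift ord0 i) (lift ord0 i) f).

Lemma tpartialEw i f (d : {fset 'rV[int]_n}) : lsupp f `<=` d ->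
  tpartial i f = \sum_(k <- d) lterm ((k 0 i)%:~R * lcoeff k f) k.
Proof.
move=> fd; rewrite /tpartial; apply: (big_fset_incl _ fd) => k _.
by move/lcoeff_outdom=> ->; rewrite mulr0 lterm0.
Qed.

Lemma tpartial_term i c k :
  tpartial i (lterm c k) = (k 0 i)%:~R *: lterm c k :> L.
Proof.
rewrite (tpartialEw i (lsupp_term _ _)) big_seq_fset1.
by rewrite lcoeff_term eqxx ltermZ.
Qed.

Lemma lcoeff_tpartial i f k :
  lcoeff k (tpartial i f) = (k 0 i)%:~R * lcoeff k f.
Proof.
have coeff_sum (s : seq 'rV[int]_n) (F : 'rV[int]_n -> L) :
    lcoeff k (\sum_(l <- s) F l) = \sum_(l <- s) lcoeff k (F l).
  elim: s => [|l s IHs]; first by rewrite !big_nil lcoeff0.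
  by rewrite !big_cons lcoeffD IHs.
rewrite /tpartial coeff_sum [in RHS](lexpand f) coeff_sum mulr_sumr.
apply: eq_bigr => l _; rewrite !lcoeff_term.
by case: eqP => [->|_]; rewrite ?mulr0 // !mulr1n.
Qed.

Lemma tpartial_linear i : linear (@tpartial i).
Proof.
move=> c f g; apply: lcoeffP => k.
have E : lcoeff k (c *: f + g) = c * lcoeff k f + lcoeff k g.
  exact: etrans (lcoeffD _ _ _) (congr1 (+%R^~ _) (lcoeffZ _ _ _)).
have E' : lcoeff k (c *: tpartial i f + tpartial i g)
    = c * ((k 0 i)%:~R * lcoeff k f) + (k 0 i)%:~R * lcoeff k g.
  apply: etrans (lcoeffD _ _ _) _; congr (_ + _); last exact: lcoeff_tpartial.
  exact: etrans (lcoeffZ _ _ _) (congr1 _ (lcoeff_tpartial _ _ _)).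
apply: etrans (lcoeff_tpartial _ _ _) _; apply/esym/(etrans E').
by apply/esym/(etrans (congr1 _ E)); rewrite mulrDr mulrCA.
Qed.

HB.instance Definition _ i :=
  GRing.isLinear.Build C L L *:%R (@tpartial i) (tpartial_linear i).

Lemma tpartialM i f g : tpartial i (f * g) = tpartial i f * g + f * tpartial i g.
Proof.
rewrite (lexpand f) mulr_suml !raddf_sum !mulr_suml -big_split /=.
apply: eq_bigr => k _.
rewrite (lexpand g) mulr_sumr !raddf_sum !mulr_sumr -big_split /=.
apply: eq_bigr => l _.
rewrite ltermM !tpartial_term -scalerAl -scalerAr ltermM -scalerDl.
by rewrite mxE intrD.
Qed.

Lemma witt_D_is_derivation u j : is_derivation (witt_D u j).
Proof.
split=> [c f g|f g]; rewrite /witt_D.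
  rewrite scalerAr -mulrDr scaler_sumr -big_split /=; congr (_ * _).
  apply: eq_bigr => i _.
  by rewrite linearP scalerDr !scalerA mulrC.
rewrite -mulrA [f * (_ * _)]mulrCA -mulrDr; congr (_ * _).
rewrite mulr_suml [X in _ = _ + X]mulr_sumr -big_split /=; apply: eq_bigr => i _.
by rewrite tpartialM scalerDr -scalerAl -scalerAr.
Qed.

Lemma tpartial_is_derivation i : is_derivation (@tpartial i).
Proof. by split; [exact: tpartial_linear | exact: tpartialM]. Qed.

Lemma derivation_ext (x y : L -> L) : x =1 y -> is_derivation x ->
  is_derivation y.
Proof.
by move=> xy [xl xM]; split=> [c f g|f g]; rewrite -!xy; [exact: xl | exact: xM].
Qed.

Lemma derivation0 : is_derivation (fun=> 0).
Proof.
split=> [c f g|f g]; first by rewrite scaler0 addr0.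
by rewrite mul0r mulr0 addr0.
Qed.

Lemma derivationD (x y : L -> L) : is_derivation x -> is_derivation y ->
  is_derivation (fun f => x f + y f).
Proof.
move=> [xl xM] [yl yM]; split=> [c f g|f g].
  by rewrite xl yl scalerDr addrACA.
by rewrite xM yM mulrDl mulrDr addrACA.
Qed.

Lemma derivationM (h : L) (x : L -> L) : is_derivation x ->
  is_derivation (fun f => h * x f).
Proof.
move=> [xl xM]; split=> [c f g|f g]; first by rewrite xl mulrDr -scalerAr.
by rewrite xM mulrDr mulrA mulrCA.
Qed.

Lemma derivationZ c (x : L -> L) : is_derivation x ->
  is_derivation (fun f => c *: x f).
Proof.
move=> /(derivationM (c%:A)); apply: derivation_ext => f.
by rewrite mulr_algl.
Qed.

Lemma derivationN (x : L -> L) : is_derivation x ->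
  is_derivation (fun f => - x f).
Proof.
by move=> /(derivationM (-1)); apply: derivation_ext => f; rewrite mulN1r.
Qed.

Lemma derivation_sum (I : Type) (r : seq I) (P : pred I) (x : I -> L -> L) :
  (forall i, is_derivation (x i)) ->
  is_derivation (fun f => \sum_(i <- r | P i) x i f).
Proof.
move=> xP; elim: r => [|i r IHr].
  by apply: derivation_ext derivation0 => f; rewrite big_nil.
case Pi: (P i); last by apply: derivation_ext IHr => f; rewrite big_cons Pi.
by apply: derivation_ext (derivationD (xP i) IHr) => f; rewrite big_cons Pi.
Qed.

Lemma witt_D_term u j c k : witt_D u j (lterm c k) = lterm (c * pairing u k) (j + k).
Proof.
rewrite /witt_D; have -> : \sum_(i < n) u 0 i *: tpartial i (lterm c k)
    = lterm (c * pairing u k) k.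
  rewrite mulrC -ltermZ /pairing scaler_suml; apply: eq_bigr => i _.
  by rewrite tpartial_term scalerA.
by rewrite /tmon ltermM mul1r.
Qed.

Lemma witt_D_bracket u v j k f : witt_D u j (witt_D v k f) - witt_D v k (witt_D u j f)
  = witt_D (pairing u k *: v - pairing v j *: u) (j + k) f.
Proof.
have pairB c w c' w' l :
    pairing (c *: w - c' *: w') l = c * pairing w l - c' * pairing w' l.
  rewrite /pairing !mulr_sumr -sumrB; apply: eq_bigr => i _.
  by rewrite !mxE mulrBl !mulrA.
have pairD w l l' : pairing w (l + l') = pairing w l + pairing w l'.
  rewrite /pairing -big_split /=; apply: eq_bigr => i _.
  by rewrite mxE intrD mulrDr.
have Dsum w l (s : seq 'rV[int]_n) F :
    witt_D w l (\sum_(i <- s) F i) = \sum_(i <- s) witt_D w l (F i).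
  have [Dl _] := witt_D_is_derivation w l.
  pose dA := GRing.isLinear.Build _ _ _ _ (witt_D w l) Dl.
  pose d : {linear L -> L} := HB.pack (witt_D w l) dA.
  exact: (linear_sum d).
rewrite (lexpand f) !Dsum -sumrB; apply: eq_bigr => l _.
rewrite !witt_D_term pairB !pairD (addrCA k j) addrA.
set m := j + k + l; set c := lcoeff _ _.
rewrite -[- lterm _ m]scaleN1r ltermZ -ltermD; congr (lterm _ m).
ring.
Qed.

Lemma sl_e_is_derivation i j : is_derivation (sl_e i j).
Proof.
have Dsum : is_derivation (fun f => \sum_(k < n) tpartial k f).
  by apply: derivation_sum => k; exact: tpartial_is_derivation.
rewrite /sl_e; case: (unlift ord_max i) => [i'|]; case: (unlift ord_max j) => [j'|].
- exact/derivationM/tpartial_is_derivation.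
- exact/derivationN/derivationM.
- exact/derivationM/tpartial_is_derivation.
- exact/derivationN.
Qed.

Lemma sl_mem_is_derivation (x : L -> L) : sl_mem x -> is_derivation x.
Proof.
move=> [c [d xE]]; apply: derivation_ext (fun f => esym (xE f)) _.
apply: derivationD; apply: derivation_sum => i.
  by apply: derivation_sum => j; exact/derivationZ/sl_e_is_derivation.
by apply: derivationZ; apply: derivationD; [|apply: derivationN];
  exact: sl_e_is_derivation.
Qed.

End WittAlgebra.

Arguments tmon {C n} j.
Arguments sl_mem {C n} x.

(* ------------------------------------------------------------------------ *)
Section Omega.
Variables (C : fieldType) (n : nat).
Local Notation L := (laurent C n).
Local Notation V := {mpoly C[n]}.

(* f(partial_1 - j_1, ..., partial_n - j_n), the indeterminate partial_i
   being 'X_i. *)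
Definition shift (j : 'rV[int]_n) (f : V) : V :=
  f \mPo [tuple 'X_i - ((j 0 i)%:~R)%:MP | i < n].

(* The action of D(u,j) on Omega_{1-a}(lam): the argument is a, not 1 - a. *)
Definition omega_D (a : C) (lam : 'I_n -> C)
    (u : 'rV[C]_n) (j : 'rV[int]_n) (f : V) : V :=
  (\prod_(i < n) lam i ^ j 0 i) *:
    ((\sum_(i < n) u 0 i *: 'X_i - (a * pairing u j)%:MP) * shift j f).

(* A derivation x is \sum_i (t_i^-1 x(t_i)) partial_i, so the coefficient of
   t^j in t_i^-1 x(t_i) is that of D(delta_mx 0 i, j) in x. *)
Definition witt_coord (x : L -> L) (i : 'I_n) : L :=
  tmon (- eps i) * x (tmon (eps i)).

(* The action of a derivation x on Omega_{1-a}(lam): the extension of omega_D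
   by linearity, see omega_act_D and omega_act_linear; the witt_D u j span
   the derivations by witt_expand. *)
Definition omega_act (a : C) (lam : 'I_n -> C) (x : L -> L) (f : V) : V :=
  \sum_(i < n) \sum_(j <- lsupp (witt_coord x i))
    lcoeff j (witt_coord x i) *: omega_D a lam (delta_mx 0 i) j f.

Lemma omega_DE a lam u j f : omega_D a lam u j f =
  \sum_(i < n) u 0 i *: omega_D a lam (delta_mx 0 i) j f.
Proof.
have pairE i : pairing (delta_mx 0 i : 'rV[C]_n) j = (j 0 i)%:~R.
  rewrite /pairing (bigD1 i) //= big1 ?addr0 ?mxE ?eqxx ?mul1r // => k ki.
  by rewrite mxE (negPf ki) andbF mul0r.
have sumE i : \sum_(k < n) (delta_mx 0 i : 'rV[C]_n) 0 k *: ('X_k : V) = 'X_i.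
  rewrite (bigD1 i) //= big1 ?addr0 ?mxE ?eqxx ?scale1r // => k ki.
  by rewrite mxE (negPf ki) andbF scale0r.
rewrite /omega_D; under [RHS]eq_bigr => i _ do
  rewrite sumE pairE scalerA mulrC -scalerA scalerAl.
rewrite -scaler_sumr -mulr_suml; congr (_ *: (_ * _)).
rewrite /pairing mulr_sumr rmorph_sum -sumrB /=; apply: eq_bigr => i _.
by rewrite scalerBr -mul_mpolyC -[X in _ = _ - X]mul_mpolyC -rmorphM mulrCA.
Qed.

Lemma witt_coord_D u j i : witt_coord (witt_D u j) i = lterm (u 0 i) j.
Proof.
rewrite /witt_coord /witt_D mulrCA (bigD1 i) //= big1 ?addr0.
  rewrite /tmon tpartial_term !mxE !eqxx scale1r ltermZ !ltermM addNr addr0.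
  by rewrite ?mulr1 ?mul1r.
move=> k ki; rewrite tpartial_term.
by rewrite !mxE (negPf ki) andbF scale0r scaler0.
Qed.

Lemma omega_act_D a lam u j f :
  omega_act a lam (witt_D u j) f = omega_D a lam u j f.
Proof.
rewrite omega_DE; apply: eq_bigr => i _; rewrite witt_coord_D.
by rewrite (lsupp_sumw _ (lsupp_term _ _)) big_seq_fset1 lcoeff_term eqxx.
Qed.

Lemma omega_act_linear a lam c (x y z : L -> L) f :
  (forall g, z g = c *: x g + y g) ->
  omega_act a lam z f = c *: omega_act a lam x f + omega_act a lam y f.
Proof.
move=> zE; rewrite /omega_act scaler_sumr -big_split /=.
apply: eq_bigr => i _; have wE : witt_coord z i = c *: witt_coord x i + witt_coord y i.
  by rewrite /witt_coord zE mulrDr scalerAr.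
set X := witt_coord x i in wE *; set Y := witt_coord y i in wE *.
set Z := witt_coord z i in wE *.
pose d := (lsupp X `|` lsupp Y `|` lsupp Z).
rewrite !(@lsupp_sumw _ _ _ _ _ d); first last.
- by rewrite fsubsetUr.
- by rewrite /d -fsetUA fsubsetUl.
- by rewrite /d fsetUAC fsubsetUr.
rewrite scaler_sumr -big_split /=; apply: eq_bigr => k _.
rewrite wE lcoeffD lcoeffZ scalerDl; congr (_ + _).
by rewrite [RHS]scalerA.
Qed.

Lemma witt_expand x f : is_derivation x ->
  x f = \sum_(i < n) \sum_(j <- lsupp (witt_coord x i))
     lcoeff j (witt_coord x i) *: witt_D (delta_mx 0 i) j f.
Proof.
move=> [xlin xM].
have tmonM j k : tmon (j + k) = tmon j * tmon k :> L.
  by rewrite /tmon ltermM mulr1.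
have tmonK j : tmon (- j) * tmon j = 1 :> L by rewrite -tmonM addNr.
pose h (k : 'rV[int]_n) := tmon (- k) * x (tmon k).
have hD j k : h (j + k) = h j + h k.
  rewrite /h tmonM xM opprD tmonM mulrDr; congr (_ + _).
    by rewrite -mulrA (mulrC (x _)) [tmon (- k) * _]mulrA tmonK mul1r.
  by rewrite mulrACA tmonK mul1r.
have hB : zmod_morphism h.
  by move=> j k; apply: (addIr (h k)); rewrite -hD !subrK.
pose hA := GRing.isZmodMorphism.Build _ _ h hB.
pose H : {additive 'rV[int]_n -> L} := HB.pack h hA.
have hE k : h k = \sum_(i < n) (k 0 i)%:~R *: h (eps i).
  have hsum (F : 'I_n -> 'rV[int]_n) : h (\sum_i F i) = \sum_i h (F i).
    exact: (raddf_sum H).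
  have hMz m v : h (v *~ m) = h v *~ m by exact: (raddfMz H).
  rewrite {1}[k]row_sum_delta hsum; apply: eq_bigr => i _.
  by rewrite -[k 0 i in LHS]intz scaler_int hMz scaler_int.
have xt k : x (tmon k) = \sum_(i < n) (k 0 i)%:~R *: (h (eps i) * tmon k).
  under eq_bigr => i _ do rewrite scalerAl.
  by rewrite -mulr_suml -hE /h mulrAC tmonK mul1r.
have xf : x f = \sum_(i < n) h (eps i) * tpartial i f.
  pose xA := GRing.isLinear.Build _ _ _ _ x xlin.
  pose X : {linear L -> L} := HB.pack x xA.
  have tE k : lterm (lcoeff k f) k = lcoeff k f *: tmon k.
    by rewrite /tmon ltermZ mulr1.
  have xsum (s : seq 'rV[int]_n) F : x (\sum_(k <- s) F k) = \sum_(k <- s) x (F k).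
    exact: (linear_sum X).
  have xZ c g : x (c *: g) = c *: x g by exact: (linearZ_LR X).
  rewrite {1}(lexpand f) xsum.
  have pE i : h (eps i) * tpartial i f
      = \sum_(k <- lsupp f) h (eps i) * tpartial i (lterm (lcoeff k f) k).
    by rewrite {1}(lexpand f) linear_sum mulr_sumr.
  rewrite (eq_bigr _ (fun i _ => pE i)).
  rewrite exchange_big; apply: eq_bigr => k _ /=.
  rewrite tE xZ xt scaler_sumr; apply: eq_bigr => i _.
  have pt : tpartial i (tmon k) = (k 0 i)%:~R *: tmon k :> L.
    by rewrite /tmon tpartial_term.
  have tZ c g : tpartial i (c *: g) = c *: tpartial i g by exact: linearZ_LR.
  by rewrite tZ pt scalerAr scalerAr.
rewrite xf; apply: eq_bigr => i _.
rewrite {1}[h _](lexpand (witt_coord x i)) mulr_suml.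
apply: eq_bigr => j _; rewrite /witt_D (bigD1 i) //= big1 ?addr0; last first.
  by move=> k ki; rewrite mxE (negPf ki) andbF scale0r.
by rewrite mxE !eqxx scale1r scalerAl /tmon ltermZ mulr1.
Qed.

Lemma shiftM j f g : shift j (f * g) = shift j f * shift j g.
Proof. exact: rmorphM. Qed.

Lemma shiftD j k f : shift j (shift k f) = shift (j + k) f.
Proof.
elim/mpolyind: f => [|c m f _ _ IHf]; first by rewrite /shift !comp_mpoly0.
rewrite /shift !comp_mpolyD -!/(shift _ _) IHf; congr (_ + _).
rewrite /shift !comp_mpolyZ; congr (_ *: _).
rewrite !comp_mpolyX rmorph_prod /=; apply: eq_bigr => i _.
rewrite rmorphXn /= !tnth_mktuple comp_mpolyB comp_mpolyC comp_mpolyXU.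
rewrite -tnth_nth tnth_mktuple -addrA -opprD -rmorphD /=; congr ((_ - _%:MP) ^+ _).
by rewrite mxE intrD.
Qed.

Lemma omega_D_bracket a lam u v j k f : (forall i, lam i != 0) ->
  omega_D a lam u j (omega_D a lam v k f)
    - omega_D a lam v k (omega_D a lam u j f)
  = omega_D a lam (pairing u k *: v - pairing v j *: u) (j + k) f.
Proof.
move=> lam0.
pose ell (w : 'rV[C]_n) : V := \sum_(i < n) w 0 i *: 'X_i.
have shiftE w l c : shift l (ell w - c%:MP) = ell w - (pairing w l)%:MP - c%:MP.
  rewrite /shift comp_mpolyB comp_mpolyC; congr (_ - _).
  rewrite /ell /pairing !rmorph_sum /= -sumrB; apply: eq_bigr => i _.
  rewrite comp_mpolyZ comp_mpolyXU -tnth_nth tnth_mktuple scalerBr.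
  by rewrite -[X in _ - X]mul_mpolyC -rmorphM.
have ellB c w c' w' : ell (c *: w - c' *: w') = c%:MP * ell w - c'%:MP * ell w'.
  rewrite /ell !mulr_sumr -sumrB; apply: eq_bigr => i _.
  by rewrite !mxE scalerBl !mul_mpolyC !scalerA.
have pairB c w c' w' l :
    pairing (c *: w - c' *: w') l = c * pairing w l - c' * pairing w' l.
  rewrite /pairing !mulr_sumr -sumrB; apply: eq_bigr => i _.
  by rewrite !mxE mulrBl !mulrA.
have pairD w l l' : pairing w (l + l') = pairing w l + pairing w l'.
  rewrite /pairing -big_split /=; apply: eq_bigr => i _.
  by rewrite mxE intrD mulrDr.
have lamD (l l' : 'rV[int]_n) : \prod_i lam i ^ (l + l') 0 i
    = (\prod_i lam i ^ l 0 i) * \prod_i lam i ^ l' 0 i.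
  by rewrite -big_split /=; apply: eq_bigr => i _; rewrite mxE expfzDr.
have shiftZ l c g : shift l (c *: g) = c *: shift l g by exact: comp_mpolyZ.
rewrite /omega_D -!/(ell _) !shiftZ !shiftM !shiftE !shiftD lamD ellB pairB !pairD.
rewrite -!mul_mpolyC (addrC k j); set F := shift _ f.
move: (ell u) (ell v) F => U W F.
rewrite !(rmorphM, rmorphD, rmorphB) /=.
ring.
Qed.

End Omega.

(* ------------------------------------------------------------------------ *)
(* V and W are isomorphic as modules over the Lie algebra of the x : M with g x,
   which acts on V by rho and on W by sigma. *)
Definition lie_module_iso (C : fieldType) (M : Type) (V W : lmodType C)
    (g : M -> Prop) (rho : M -> V -> V) (sigma : M -> W -> W) : Prop :=
  exists phi : {linear V -> W}, bijective phi /\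
    forall x : M, g x -> forall v : V, phi (rho x v) = sigma x (phi v).

(* Main.v *)
Require Import Defs.
From mathcomp Require Import all_boot all_order all_algebra.
From mathcomp Require Import reals complex mpoly.

Set Implicit Arguments.
Unset Strict Implicit.
Unset Printing Implicit Defensive.

Import GRing.Theory.
Local Open Scope ring_scope.

(** The parameters a and lam are already visible to the Cartan subalgebra
together with the lowering operators e_(n+1,i) = t_i^-1 d_i.

The Cartan subalgebra acts on Omega by multiplication by linear forms,
independently of a and lam, and in characteristic not dividing n + 1 it is
spanned by d_1, ..., d_n, which act as the indeterminates
([omega_hom_mulX]). A homomorphism phi of sl_(n+1)-modules is therefore
C[d_1, ..., d_n]-linear, so it is multiplication by phi 1
([mpoly_linear_mul]). If phi is bijective, phi 1 is invertible in the
polynomial ring, that is, a nonzero constant c ([mpoly_mul_eq1]).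

Constants are fixed by the shift, so e_(n+1,i) sends c to
c lam_i^-1 (d_i + a) ([omega_D_lowering]). Comparing phi (e_(n+1,i) 1) with
e_(n+1,i) (phi 1) gives lam_i^-1 (d_i + a) = lam'_i^-1 (d_i + a'); the
coefficient of d_i gives lam_i = lam'_i, and then the constant term gives
a = a' ([omega_iso_parameters]). *)

Section SlInWitt.
Variables (C : fieldType) (n : nat).

(** The coordinates of e_jj in the basis d_1, ..., d_n; the last row stands for
e_(n+1,n+1) = - (d_1 + ... + d_n). *)
Definition diag_row (j : 'I_n.+1) : 'rV[C]_n :=
  if unlift ord_max j is Some j' then delta_mx 0 j' else - const_mx 1.

Lemma tmon0 : tmon 0 = 1 :> laurent C n.
Proof. by []. Qed.

Lemma witt_D_delta i j f :
  witt_D (delta_mx 0 i : 'rV[C]_n) j f = tmon j * tpartial i f.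
Proof.
rewrite /witt_D (bigD1 i) //= big1 ?addr0 ?mxE ?eqxx ?scale1r // => k ki.
by rewrite mxE (negPf ki) andbF scale0r.
Qed.

Lemma sl_e_diag j f : sl_e j j f = witt_D (diag_row j) 0 f.
Proof.
rewrite /sl_e /diag_row; case: (unlift ord_max j) => [i|].
  by rewrite witt_D_delta /tmon ltermM addrN mulr1.
rewrite /witt_D tmon0 mul1r -sumrN; apply: eq_bigr => i _.
by rewrite !mxE scaleN1r.
Qed.

(** The relation e_11 + ... + e_(n+1,n+1) = 0 in the Witt algebra. It is what
places each single e_jj in sl_(n+1) when n + 1 is invertible, although only their
differences are among the generators. *)
Lemma sum_diag_row : \sum_j diag_row j = 0.
Proof.
rewrite big_ord_recr /= {2}/diag_row unlift_none.
apply/rowP=> k; rewrite !mxE summxE (bigD1 k) //= big1 => [|i ik].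
  rewrite /diag_row [widen_ord _ _](_ : _ = lift ord_max k); last first.
    by apply: val_inj; rewrite /= /bump leqNgt ltn_ord.
  by rewrite liftK mxE !eqxx addr0 subrr.
rewrite /diag_row [widen_ord _ _](_ : _ = lift ord_max i); last first.
  by apply: val_inj; rewrite /= /bump leqNgt ltn_ord.
by rewrite liftK mxE eq_sym (negPf ik) andbF.
Qed.

Lemma witt_DB (u v : 'rV[C]_n) j f :
  witt_D (u - v) j f = witt_D u j f - witt_D v j f.
Proof.
rewrite /witt_D -mulrBr -sumrB; congr (_ * _); apply: eq_bigr => i _.
by rewrite !mxE scalerBl.
Qed.

Lemma sl_mem_diag i :
  sl_mem (witt_D (diag_row (widen_ord (leqnSn n) i) - diag_row (lift ord0 i)) 0).
Proof.
exists 0, (delta_mx 0 i) => f; rewrite big1 ?add0r => [|k _]; last first.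
  by rewrite big1 // => l _; rewrite mxE scale0r.
rewrite (bigD1 i) //= big1 ?addr0 => [|k ki]; last first.
  by rewrite mxE (negPf ki) andbF scale0r.
by rewrite mxE !eqxx scale1r !sl_e_diag witt_DB.
Qed.

Lemma sl_mem_lowering i : sl_mem (witt_D (delta_mx 0 i : 'rV[C]_n) (- eps i)).
Proof.
exists (delta_mx ord_max (lift ord_max i)), 0 => f.
rewrite [X in _ + X]big1 ?addr0 => [|k _]; last by rewrite mxE scale0r.
rewrite (bigD1 ord_max) //= [X in _ + X]big1 ?addr0 => [|k kN]; last first.
  by rewrite big1 // => l _; rewrite mxE (negPf kN) scale0r.
rewrite (bigD1 (lift ord_max i)) /=; last by rewrite eq_sym neq_lift.
rewrite big1 ?addr0 => [|l /andP[_ li]]; last first.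
  by rewrite mxE (negPf li) andbF scale0r.
by rewrite mxE !eqxx scale1r witt_D_delta /sl_e unlift_none liftK.
Qed.

End SlInWitt.

Section OmegaAction.
Variables (C : fieldType) (n : nat).
Implicit Types (a : C) (lam : 'I_n -> C) (f : {mpoly C[n]}).

(** In degree 0 there is no shift, the factor built from lam is 1 and (u|0) = 0:
neither a nor lam is left. *)
Lemma omega_D_cartan a lam u f :
  omega_D a lam u 0 f = (\sum_(i < n) u 0 i *: 'X_i) * f.
Proof.
rewrite /omega_D big1 => [|i _]; last by rewrite mxE expr0z.
have -> : pairing u 0 = 0 by apply: big1 => i _; rewrite mxE mulr0.
rewrite scale1r mulr0 mpolyC0 subr0 /shift; congr (_ * _).
rewrite -[RHS]comp_mpoly_id; congr (f \mPo _).
by apply: eq_mktuple => i; rewrite mxE mpolyC0 subr0.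
Qed.

(** On constants the shift is invisible, which isolates the dependence on a and
lam i. The sign of a comes from pairing with - eps i. *)
Lemma omega_D_lowering a lam i c :
  omega_D a lam (delta_mx 0 i) (- eps i) c%:MP
    = ((lam i)^-1 * c) *: ('X_i + a%:MP).
Proof.
have lamE : \prod_(k < n) lam k ^ (- eps i : 'rV[int]_n) 0 k = (lam i)^-1.
  rewrite (bigD1 i) //= big1 ?mulr1 => [|k ki]; first by rewrite !mxE !eqxx.
  by rewrite !mxE (negPf ki) andbF expr0z.
have XE : \sum_(k < n) (delta_mx 0 i : 'rV[C]_n) 0 k *: 'X_k = 'X_i :> {mpoly C[n]}.
  rewrite (bigD1 i) //= big1 ?addr0 ?mxE ?eqxx ?scale1r // => k ki.
  by rewrite mxE (negPf ki) andbF scale0r.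
have pairE : pairing (delta_mx 0 i : 'rV[C]_n) (- eps i) = -1.
  rewrite /pairing (bigD1 i) //= big1 ?addr0 ?mxE ?eqxx ?mul1r // => k ki.
  by rewrite !mxE (negPf ki) andbF mul0r.
rewrite /omega_D lamE XE pairE mulrN1 mpolyCN opprK /shift comp_mpolyC.
by rewrite mulrC mul_mpolyC scalerA.
Qed.

Lemma eq_omega_act a lam lam' x f :
  lam =1 lam' -> omega_act a lam x f = omega_act a lam' x f.
Proof.
move=> eq_lam; apply: eq_bigr => i _; apply: eq_bigr => j _.
by rewrite /omega_D; congr (_ *: (_ *: _)); apply: eq_bigr => k _; rewrite eq_lam.
Qed.

End OmegaAction.

Section PolynomialModule.
Variables (C : fieldType) (n : nat) (phi : {linear {mpoly C[n]} -> {mpoly C[n]}}).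

Lemma mpoly_linear_mul :
  (forall i f, phi ('X_i * f) = 'X_i * phi f) -> forall f, phi f = f * phi 1.
Proof.
move=> phiX; have phiXE i k f : phi ('X_i ^+ k * f) = 'X_i ^+ k * phi f.
  elim: k => [|k IHk]; first by rewrite !expr0 !mul1r.
  by rewrite exprS -!mulrA phiX IHk.
have phiM m f : phi ('X_[m] * f) = 'X_[m] * phi f.
  rewrite mpolyXE_id; elim: (index_enum _) f => [|i s IHs] f.
    by rewrite big_nil !mul1r.
  by rewrite big_cons -!mulrA phiXE IHs.
elim/mpolyind=> [|c m f _ _ IHf]; first by rewrite linear0 mul0r.
by rewrite linearP IHf -['X_[m] in LHS]mulr1 phiM mulrDl scalerAl.
Qed.

End PolynomialModule.

Lemma mpoly_mul_eq1 (C : fieldType) n (p q : {mpoly C[n]}) :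
  p * q = 1 -> exists2 c, c != 0 & q = c%:MP.
Proof.
move=> /mpoly_intro_unit/andP[/eqP q_const q0_unit].
by exists q@_0; first by rewrite -unitfE.
Qed.

Section OmegaIso.
Variables (C : fieldType) (n : nat) (a a' : C) (lam lam' : 'I_n -> C).
Variable phi : {linear {mpoly C[n]} -> {mpoly C[n]}}.
Hypothesis char_n : n.+1%:R != 0 :> C.
Hypothesis phi_sl : forall x, sl_mem x ->
  forall f, phi (omega_act a lam x f) = omega_act a' lam' x (phi f).

(** The defect G u of commutation of phi with multiplication by the linear form
u is additive in u. Since phi commutes with every e_jj - e_(j+1,j+1), the defects
at all the e_jj are equal; they add up to 0, so n + 1 times each of them is 0. *)
Lemma omega_hom_mulX i f : phi ('X_i * f) = 'X_i * phi f.
Proof.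
pose ell (u : 'rV[C]_n) : {mpoly C[n]} := \sum_(i < n) u 0 i *: 'X_i.
pose G u := phi (ell u * f) - ell u * phi f.
have ellD u v : ell (u + v) = ell u + ell v.
  by rewrite -big_split; apply: eq_bigr => k _; rewrite mxE scalerDl.
have GD u v : G (u + v) = G u + G v.
  by rewrite /G ellD !mulrDl linearD opprD addrACA.
have G0 : G 0 = 0 by apply: (addrI (G 0)); rewrite -GD !addr0.
have Gstep (k : 'I_n) :
    G (diag_row C (widen_ord (leqnSn n) k)) = G (diag_row C (lift ord0 k)).
  have := phi_sl (sl_mem_diag C k) f.
  rewrite !omega_act_D !omega_D_cartan => /eqP; rewrite -subr_eq0 => /eqP Gk.
  by rewrite -[diag_row C (widen_ord _ _)](subrK (diag_row C (lift ord0 k))) GD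
    [G (_ - _)]Gk add0r.
have Gconst (j : 'I_n.+1) : G (diag_row C j) = G (diag_row C ord0).
  case: j => j; elim: j => [|j IHj] lt_j.
    by congr (G (diag_row C _)); exact: val_inj.
  rewrite -(IHj (ltnW lt_j)).
  have -> : Ordinal lt_j = lift ord0 (Ordinal (lt_j : (j < n)%N)).
    exact: val_inj.
  by rewrite -Gstep; congr (G (diag_row C _)); exact: val_inj.
have Gsum : \sum_j G (diag_row C j) = 0.
  by rewrite -(big_morph G GD G0) sum_diag_row.
have Gdiag j : G (diag_row C j) = 0.
  move/eqP: Gsum; under eq_bigr => k _ do rewrite Gconst.
  rewrite sumr_const card_ord -scaler_nat scaler_eq0 (negPf char_n) /=.
  by rewrite Gconst => /eqP.
have ellX : ell (diag_row C (lift ord_max i)) = 'X_i.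
  rewrite /ell /diag_row liftK (bigD1 i) //= big1 ?addr0 ?mxE ?eqxx ?scale1r //.
  by move=> k ki; rewrite mxE (negPf ki) andbF scale0r.
by apply/eqP; rewrite -subr_eq0 -ellX; apply/eqP/Gdiag.
Qed.

Lemma omega_iso_parameters (i : 'I_n) :
  bijective phi -> lam i != 0 -> a = a' /\ lam i = lam' i.
Proof.
case=> psi _ phiK lami0.
have phiE := mpoly_linear_mul omega_hom_mulX.
have [c c0 phi1] : exists2 c, c != 0 & phi 1 = c%:MP.
  by apply: (mpoly_mul_eq1 (p := psi 1)); rewrite -phiE phiK.
have := phi_sl (sl_mem_lowering C i) 1.
rewrite !omega_act_D phi1 -[X in omega_D _ _ _ _ X]mpolyC1 !omega_D_lowering.
rewrite phiE phi1 mulrC mul_mpolyC scalerA mulr1 [c * _]mulrC => E.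
have EX : (lam i)^-1 = (lam' i)^-1.
  have := congr1 (mcoeff U_(i)) E.
  rewrite !mcoeffZ !mcoeffD !mcoeffXU !mcoeffC eqxx mnm1_eq0.
  rewrite !mulr0 !addr0 !mulr1.
  exact: mulIf.
have := congr1 (mcoeff 0%MM) E.
rewrite !mcoeffZ !mcoeffD !mcoeffX mnm1_eq0 !mcoeffC eqxx !add0r !mulr1 -EX.
move/(mulfI (mulf_neq0 (invr_neq0 lami0) c0)).
by split=> //; apply: invr_inj.
Qed.

End OmegaIso.

Theorem theorem18 (R : realType) (n : nat) (a a' : R[i])
    (lam lam' : 'I_n -> R[i]) :
  (2 <= n)%N -> a != 0 -> a' != 0 ->
  (forall i : 'I_n, lam i != 0) -> (forall i : 'I_n, lam' i != 0) ->
  (lie_module_iso (V := {mpoly R[i][n]}) (W := {mpoly R[i][n]})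
     sl_mem (omega_act a lam) (omega_act a' lam')
   <-> a = a' /\ forall i : 'I_n, lam i = lam' i).
Proof.
move=> n2 a0 a'0 lam0 lam'0; split=> [[phi [phi_bij phi_sl]]|[<- eq_lam]].
  have char_n : n.+1%:R != 0 :> R[i] by rewrite Num.Theory.pnatr_eq0.
  have param i := omega_iso_parameters char_n phi_sl phi_bij (lam0 i).
  by split=> [|i]; [case: (param (Ordinal (ltnW n2))) | case: (param i)].
exists idfun; split=> [|x _ v]; first by exists id.
exact: eq_omega_act.
Qed.
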